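(* Let $A\subset B$ be a minimal ring extension with crucial ideal $M$. Then $A\subset B$ is a PSI-extension if and only if either $A\subset B$ is not finite, or $A\subset B$ is finite and $M$ is a maximal ideal of $B$.
   Context: All rings are commutative and unitary, and ring morphisms are unitary. For a ring extension $A\subseteq B$, a proper ideal $I$ of $B$ is called $A$-prime if $ab\in I$ with $a\in A$ and $b\in B$ implies that $a\in I$ or $b\in I$. The extension $A\subseteq B$ is a PSI-extension if every $A$-prime ideal of $B$ is a prime ideal of $B$. A proper ring extension $A\subset B$ is minimal if there is no ring $C$ with $A\subset C\subset B$ (proper inclusions). In this case there exists a maximal ideal $M$ of $A$, called the crucial ideal of $A\subset B$, such that $A_P=B_P$ for each $P\in\mathrm{Spec}(A)\setminus\{M\}$ (and $A_M\subset B_M$ properly), where $B_P$ is the localization of $B$ at the multiplicative set $A\setminus P$. The extension is finite if $B$ is a finitely generated $A$-module. *)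

(* Defs.v *)
From HB Require Import structures.
From mathcomp Require Import all_boot all_order all_algebra.
From mathcomp Require Import boolp classical_sets.

Set Implicit Arguments.
Unset Strict Implicit.
Unset Printing Implicit Defensive.

Import GRing.Theory.
Local Open Scope ring_scope.
Local Open Scope classical_set_scope.

(* A ring extension A ⊆ B is a commutative ring B with a subring A of B, given
   as a subset of B. The ring B itself is the subring [setT], and notions that
   are relative to a subring A (such as "ideal of A") are those of the ring B
   when A is [setT]. In this way a subset of A, such as the crucial ideal, can
   be regarded both as an ideal of A and as a candidate ideal of B. *)

Section RingExtensions.
Variable B : comPzRingType.
Implicit Types A C E I J M P S : set B.

Definition subring A : Prop := GRing.subring_closed (mem A).

Definition ideal_of A I : Prop :=
  [/\ I `<=` A, I 0, (forall x y, I x -> I y -> I (x + y))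
    & (forall a x, A a -> I x -> I (a * x))].

Definition proper_ideal_of A I : Prop := ideal_of A I /\ I <> A.

Definition prime_ideal_of A P : Prop :=
  proper_ideal_of A P /\
  (forall a b, A a -> A b -> P (a * b) -> P a \/ P b).

Definition maximal_ideal_of A M : Prop :=
  proper_ideal_of A M /\ (forall J, proper_ideal_of A J -> M `<=` J -> J = M).

Definition A_prime_ideal A I : Prop :=
  proper_ideal_of setT I /\ (forall a b, A a -> I (a * b) -> I a \/ I b).

Definition PSI_extension A : Prop :=
  forall I, A_prime_ideal A I -> prime_ideal_of setT I.

Definition minimal_extension A : Prop :=
  [/\ subring A, A `<` setT
    & ~ exists C, [/\ subring C, A `<` C & C `<` setT]].

Definition finite_extension A : Prop :=
  exists (n : nat) (e : 'I_n -> B), forall b : B,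
    exists2 c : 'I_n -> B, (forall i, A (c i)) & b = \sum_(i < n) c i * e i.

(* The fraction x/s of S^-1 B, as an equivalence class of pairs (y, t) with
   y in B and t in S. *)
Definition fraction S (x s : B) : set (B * B) :=
  [set p | S p.2 /\ exists2 u, S u & u * (x * p.2 - p.1 * s) = 0].

(* S^-1 E, for a subring E of B that contains S, as the subring of S^-1 B made
   of the fractions with numerator in E. The canonical map from S^-1 E to
   S^-1 B is injective because S is a subset of E. *)
Definition localization S E : set (set (B * B)) :=
  [set fraction S p.1 p.2 | p in E `*` S].

Definition localization_at A P E : set (set (B * B)) :=
  localization (A `\` P) E.

Definition crucial_ideal A M : Prop :=
  [/\ maximal_ideal_of A M,
      (forall P, prime_ideal_of A P -> P <> M ->
         localization_at A P A = localization_at A P setT)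
    & localization_at A M A `<` localization_at A M setT].

End RingExtensions.

(* Main.v *)
Require Import Defs.
From mathcomp Require Import all_boot all_order all_algebra.
From mathcomp Require Import boolp classical_sets.
From mathcomp Require Import ring.

(** Everything rests on the fact that a subring of [B] containing [A] is [A] or
    [B], applied to the subrings [A + J], for [J] an ideal of [B], and to
    [A[x]].

    The first result is that [B] is finite over [A] if and only if [M] is an
    ideal of [B].  If [B] is finite and [J = MB], then [A + J = B] is impossible
    by Nakayama's lemma, because [A_M] and [B_M] differ; so [J] is contained in
    [A], and [M = J] by maximality ([finite_crucial_ideal]).  If [M] is an ideal
    of [B], then [A/M] is a field and [B = A[x]] for any [x] outside [A]; either
    [x^2] is in [A], or [A + x^2 B = B] gives the class of [x] in [B/M] an
    algebraic equation over [A/M] ([crucial_ideal_finite]).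

    If the extension is finite and PSI, then [M] is an [A]-prime ideal of [B],
    because [A/M] is a field; hence it is prime, and the subrings [A + J] and
    [A + x^2 B] show that it is then maximal ([prime_crucial_maximal]).

    Conversely, let [I] be [A]-prime, with trace [P] on [A].  If [P <> M], then
    [A_P = B_P] and the primality of [P] passes to [I]
    ([A_prime_local]).  If [P = M] and [A + I = B], then [A]-primality is
    primality modulo [I] ([A_prime_sum]).  Otherwise [I] is contained in [A],
    so that [I = M]; then [B] is finite over [A], and [M] is maximal in [B] by
    assumption. *)

Set Implicit Arguments.
Unset Strict Implicit.
Unset Printing Implicit Defensive.

Import GRing.Theory.
Local Open Scope ring_scope.
Local Open Scope classical_set_scope.

Section Minimal.
Variable B : comPzRingType.
Implicit Types A C I J M P S W : set B.

(** * Subrings and ideals *)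

Lemma subringP C :
  subring C <-> [/\ C 1, (forall x y, C x -> C y -> C (x - y))
                  & (forall x y, C x -> C y -> C (x * y))].
Proof.
split=> -[h1 hB hM]; split.
- by move: h1; rewrite in_setE.
- by move=> x y hx hy; move: (hB x y); rewrite !in_setE; apply.
- by move=> x y hx hy; move: (hM x y); rewrite !in_setE; apply.
- by rewrite in_setE.
- by move=> x y; rewrite !in_setE; apply: hB.
- by move=> x y; rewrite !in_setE; apply: hM.
Qed.

Lemma subring1 C : subring C -> C 1.
Proof. by case/subringP. Qed.

Lemma subringB C x y : subring C -> C x -> C y -> C (x - y).
Proof. by case/subringP=> _ + _; apply. Qed.

Lemma subringM C x y : subring C -> C x -> C y -> C (x * y).
Proof. by case/subringP=> _ _; apply. Qed.

Lemma subring0 C : subring C -> C 0.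
Proof.
by move=> hC; rewrite -(subrr 1); apply: subringB => //; apply: subring1.
Qed.

Lemma subringN C x : subring C -> C x -> C (- x).
Proof. by move=> hC hx; rewrite -sub0r; apply: subringB => //; apply: subring0. Qed.

Lemma subringD C x y : subring C -> C x -> C y -> C (x + y).
Proof.
by move=> hC hx hy; rewrite -[y]opprK; apply: subringB => //; apply: subringN.
Qed.

Lemma subringT : subring (@setT B).
Proof. exact/subringP. Qed.

Lemma idealN A I x : subring A -> ideal_of A I -> I x -> I (- x).
Proof.
move=> hA [_ _ _ hZ] hx; rewrite -mulN1r; apply: hZ => //.
by apply: subringN => //; apply: subring1.
Qed.

Lemma idealB A I x y : subring A -> ideal_of A I -> I x -> I y -> I (x - y).
Proof.
by move=> hA hI hx hy; case: (hI) => _ _ hD _; apply: hD => //; apply: (idealN hA).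
Qed.

Lemma principal_ideal (y : B) : ideal_of setT [set y * b | b in setT].
Proof.
split=> //.
- by exists 0; rewrite // mulr0.
- by move=> _ _ [b _ <-] [c _ <-]; exists (b + c); rewrite // mulrDr.
- by move=> a _ _ [b _ <-]; exists (a * b); rewrite // mulrCA.
Qed.

Lemma proper_ideal1 A I : subring A -> ideal_of A I -> (I <> A <-> ~ I 1).
Proof.
move=> hA [hIA _ _ hZ]; split=> [nIA I1|nI1 eIA]; last first.
  by apply: nI1; rewrite eIA; apply: subring1.
by apply: nIA; apply/seteqP; split=> // a ha; rewrite -[a]mulr1; apply: hZ.
Qed.

Lemma subring_sum_ideal A J : subring A -> ideal_of setT J ->
  subring [set a + j | a in A & j in J].
Proof.
move=> hA hJ; case: (hJ) => _ J0 hD hZ; apply/subringP; split.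
- by exists 1; [apply: subring1 | exists 0; rewrite // addr0].
- move=> _ _ [a ha [j hj <-]] [b hb [k hk <-]].
  exists (a - b); first exact: subringB.
  by exists (j - k); [exact: (idealB subringT) | ring].
- move=> _ _ [a ha [j hj <-]] [b hb [k hk <-]].
  exists (a * b); first exact: subringM.
  exists (a * k + (b + k) * j); last by ring.
  by apply: hD; apply: hZ.
Qed.

Lemma ideal_contract A I : subring A -> ideal_of setT I ->
  ideal_of A (I `&` A).
Proof.
move=> hA [_ I0 hD hZ]; split.
- by move=> x [].
- by split=> //; apply: subring0.
- by move=> x y [hx ax] [hy ay]; split; [apply: hD | apply: subringD].
- by move=> a x ha [hx ax]; split; [apply: hZ | apply: subringM].
Qed.

(** Modulo a maximal ideal every nonzero element has an inverse, which the
    ideal [M + aA] provides. *)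
Lemma maximal_inverse A M a : subring A -> maximal_ideal_of A M ->
  A a -> ~ M a -> exists2 a', A a' & M (1 - a' * a).
Proof.
move=> hA [[hM nM] maxM] ha nMa; case: (hM) => hMA M0 hD hZ.
pose J := [set m + c * a | m in M & c in A].
have hJ : ideal_of A J.
  split.
  - move=> _ [m hm [c hc <-]].
    by apply: subringD => //; [apply: hMA | apply: subringM].
  - by exists 0 => //; exists 0; [apply: subring0 | ring].
  - move=> _ _ [m hm [c hc <-]] [n hn [d hd <-]].
    exists (m + n); first exact: hD.
    by exists (c + d); [apply: subringD | ring].
  - move=> b _ hb [m hm [c hc <-]].
    exists (b * m); first exact: hZ.
    by exists (b * c); [apply: subringM | ring].
have MJ : M `<=` J.
  by move=> m hm; exists m => //; exists 0; [apply: subring0 | ring].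
have [[m hm [c hc e]]|nJ1] := EM (J 1).
  by exists c => //; rewrite -e addrK.
case: nMa; rewrite -(maxM J) //.
  by exists 0 => //; exists 1; [apply: subring1 | ring].
by split=> //; apply/(proper_ideal1 hA hJ).
Qed.

Lemma maximal_prime A M : subring A -> maximal_ideal_of A M ->
  prime_ideal_of A M.
Proof.
move=> hA hM; case: (hM) => pM _; split=> // a b ha hb hab.
have [|nMa] := EM (M a); [by left | right].
have [a' ha' hm] := maximal_inverse hA hM ha nMa.
case: pM => -[_ _ hD hZ] _.
have -> : b = a' * (a * b) + b * (1 - a' * a) by ring.
by apply: hD; apply: hZ.
Qed.

Lemma minimal_subring_eq A C : minimal_extension A -> subring C ->
  A `<=` C -> C = A \/ C = setT.
Proof.
move=> [_ _ nC] hC AC.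
have [CA|nCA] := EM (C `<=` A); first by left; apply/seteqP.
have [TC|nTC] := EM (setT `<=` C); first by right; apply/seteqP.
by case: nC; exists C; split.
Qed.

Lemma minimal_sum_ideal A J : minimal_extension A -> ideal_of setT J ->
  J `<=` A \/ forall b, exists2 a, A a & J (b - a).
Proof.
move=> hAB hJ; case: (hAB) => hA _ _; case: (hJ) => _ J0 _ _.
have AC : A `<=` [set a + j | a in A & j in J].
  by move=> a ha; exists a => //; exists 0; rewrite // addr0.
have [eC|eC] := minimal_subring_eq hAB (subring_sum_ideal hA hJ) AC.
  left=> j hj; rewrite -eC; exists 0; first exact: subring0.
  by exists j; rewrite // add0r.
right=> b; have : [set a + j | a in A & j in J] b by rewrite eC.
by move=> [a ha [j hj <-]]; exists a => //; rewrite addrC addKr.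
Qed.

Lemma proper_setT A : minimal_extension A -> exists x, ~ A x.
Proof.
move=> [_ [_ nTA] _]; apply: contrapT => h; apply: nTA => x _.
by apply: contrapT => nx; apply: h; exists x.
Qed.

(** An [A]-submodule stable under [x] is a module over [A[x]]; this spares the
    construction of [A[x]], whose role is played by the stabilizer of [W]. *)
Lemma minimal_stable_top A x W : minimal_extension A -> ~ A x ->
  W 1 -> (forall v w, W v -> W w -> W (v + w)) ->
  (forall a w, A a -> W w -> W (a * w)) -> (forall w, W w -> W (x * w)) ->
  forall z, W z.
Proof.
move=> hAB nAx W1 WD WA Wx; case: (hAB) => hA _ _.
have WN w : W w -> W (- w).
  rewrite -mulN1r; apply: WA.
  by apply: subringN => //; apply: subring1.
pose C := [set z | forall w, W w -> W (z * w)].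
have hC : subring C.
  apply/subringP; split.
  - by move=> w; rewrite mul1r.
  - move=> y z hy hz w hw; rewrite mulrBl; apply: WD; first exact: hy.
    by apply: WN; apply: hz.
  - by move=> y z hy hz w hw; rewrite -mulrA; apply: hy; apply: hz.
have [eC|eC] : C = A \/ C = setT.
- by apply: minimal_subring_eq => // a ha w; apply: WA.
- by case: nAx; rewrite -eC.
- by move=> z; rewrite -[z]mulr1; have : C z by [rewrite eC]; apply.
Qed.

(** * Spans *)

(** The coefficients range over an arbitrary set, so that both [A]-spans and
    [M]-spans are instances. *)
Definition span C (e : nat -> B) (n : nat) : set B :=
  [set z | exists2 c : nat -> B, (forall i, C (c i)) & z = \sum_(i < n) c i * e i].

Lemma spanD C e n v w : (forall x y, C x -> C y -> C (x + y)) ->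
  span C e n v -> span C e n w -> span C e n (v + w).
Proof.
move=> hD [c hc ->] [d hd ->]; exists (fun i => c i + d i).
  by move=> i; apply: hD.
by rewrite -big_split; apply: eq_bigr => i _; rewrite mulrDl.
Qed.

Lemma spanZ C D e n a w : (forall x, C x -> D (a * x)) ->
  span C e n w -> span D e n (a * w).
Proof.
move=> hCD [c hc ->]; exists (fun i => a * c i); first by move=> i; apply: hCD.
by rewrite big_distrr; apply: eq_bigr => i _; rewrite /= mulrA.
Qed.

Lemma span_sub C D e n w : C `<=` D -> span C e n w -> span D e n w.
Proof.
move=> CD hw; rewrite -[w]mul1r; apply: spanZ hw => x hx.
by rewrite mul1r; apply: CD.
Qed.

Lemma spanS C e n z :
  span C e n.+1 z <-> exists w c, [/\ span C e n w, C c & z = w + c * e n].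
Proof.
split=> [[c hc ->]|[_ [a [[c hc ->] ha ->]]]].
  exists (\sum_(i < n) c i * e i), (c n); split=> //; last by rewrite big_ord_recr.
  by exists c.
exists (fun i => if (i < n)%N then c i else a); first by move=> i; case: ifP.
rewrite big_ord_recr /= ltnn; congr (_ + _).
by apply: eq_bigr => i _; rewrite ltn_ord.
Qed.

Lemma span0 C e n : C 0 -> span C e n 0.
Proof. by move=> C0; exists (fun=> 0) => //; rewrite big1 // => i _; rewrite mul0r. Qed.

Lemma span_widen C e n w : C 0 -> span C e n w -> span C e n.+1 w.
Proof. by move=> C0 hw; apply/spanS; exists w, 0; split; rewrite // mul0r addr0. Qed.

Lemma span_head C e n a : e 0 = 1 -> C 0 -> C a -> span C e n.+1 a.
Proof.
move=> e0 C0 Ca; elim: n => [|n]; last exact: span_widen.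
apply/spanS; exists 0, a; split=> //; first exact: span0.
by rewrite e0 mulr1 add0r.
Qed.

Lemma span_shift C (x : B) n w : C 0 ->
  span C (GRing.exp x) n w -> span C (GRing.exp x) n.+1 (x * w).
Proof.
move=> C0 [c hc ->]; exists (fun i => if i is j.+1 then c j else 0).
  by case.
rewrite big_ord_recl /= mul0r add0r big_distrr; apply: eq_bigr => i _ /=.
by rewrite exprS; ring.
Qed.

Lemma span_finite A e n : (forall z, span A e n z) -> finite_extension A.
Proof.
move=> h; exists n, (fun i => e i) => b; have [c hc ->] := h b.
by exists (fun i => c i).
Qed.

(** A finite generating family may be prefixed with [1], so that the spans of
    its initial segments contain [A]. *)
Lemma finite_span A : subring A -> finite_extension A ->
  exists2 e : nat -> B, e 0 = 1 & exists n, forall z, span A e n.+1 z.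
Proof.
move=> hA [n [e he]].
pose f i := oapp e 0 (insub i).
exists (fun i => if i is j.+1 then f j else 1) => //.
exists n => z; have [c hc ->] := he z.
exists (fun i => if i is j.+1 then oapp c 0 (insub j) else 0).
  case=> [|i]; first exact: subring0.
  by case: insubP => [j _ _|_] /=; [exact: hc | exact: subring0].
rewrite big_ord_recl /= mul0r add0r; apply: eq_bigr => i _.
by rewrite /= /f valK.
Qed.

(** * Finiteness and the ideal M *)

Definition extended_ideal M : set B :=
  [set z | forall J, ideal_of setT J -> M `<=` J -> J z].

Lemma extended_ideal_ideal M : ideal_of setT (extended_ideal M).
Proof.
split=> //.
- by move=> J [].
- move=> x y hx hy J hJ MJ; case: (hJ) => _ _ hD _.
  by apply: hD; [apply: hx | apply: hy].
- move=> a x _ hx J hJ MJ; case: (hJ) => _ _ _ hZ.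
  by apply: hZ => //; exact: hx.
Qed.

Lemma sub_extended_ideal M : M `<=` extended_ideal M.
Proof. by move=> m hm J _; apply. Qed.

Lemma extended_ideal_span A M s e n z : ideal_of A M ->
  (forall b, span A e n (s * b)) ->
  extended_ideal M z -> span M e n (s * z).
Proof.
move=> [_ M0 hD hZ] hs.
(* The elements whose multiples all satisfy the conclusion form an ideal. *)
move=> /(_ [set y | forall b, span M e n (s * (y * b))]) h.
rewrite -[z]mulr1; apply: h.
  split=> //.
  - by move=> b; rewrite mul0r mulr0; apply: span0.
  - move=> x y hx hy b; rewrite mulrDl mulrDr.
    by apply: spanD.
  - by move=> a x _ hx b; rewrite (mulrC a) -mulrA; apply: hx.
move=> m hm b; rewrite mulrCA; apply: spanZ (hs b) => c hc.
by rewrite mulrC; apply: hZ.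
Qed.

(** Nakayama's lemma for [B/A] at [M]: the generators are eliminated one at a
    time, at the cost of a denominator outside [M]. *)
Lemma nakayama A M : subring A -> maximal_ideal_of A M ->
  finite_extension A ->
  (forall b, exists2 a, A a & extended_ideal M (b - a)) ->
  exists s, [/\ A s, ~ M s & forall b, A (s * b)].
Proof.
move=> hA hM hfin hB; have [e e0 [n hn]] := finite_span hA hfin.
have [[iM nM] pM] := maximal_prime hA hM.
have AD x y : A x -> A y -> A (x + y) by apply: subringD.
have A0 := subring0 hA.
have : exists s, [/\ A s, ~ M s & forall b, span A e n.+1 (s * b)].
  exists 1; split=> //; [exact: subring1|exact/(proper_ideal1 hA iM)].
elim: n {hn} => [|n IHn] [s [As nMs hs]].
  exists s; split=> // b; have [c hc ->] := hs b.
  by rewrite big_ord1 e0 mulr1.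
apply: IHn; have [a Aa hJ] := hB (e n.+1).
have /spanS[w [m [hw Mm E]]] := extended_ideal_span iM hs hJ.
case: (iM) => MA _ MD MZ.
(* Solving the equation for the last generator. *)
have he : span A e n.+1 ((s - m) * e n.+1).
  have -> : (s - m) * e n.+1 = s * a + w.
    by rewrite mulrBl -[s * e n.+1](subrK (s * a)) -mulrBr E; ring.
  by apply: spanD => //; [apply: span_head => //; apply: subringM | apply: span_sub hw].
have Asm : A (s - m) by apply: subringB => //; apply: MA.
exists (s * (s - m)); split; first exact: subringM.
  case/(pM s _ As Asm) => // h; apply: nMs.
  by rewrite -[s](subrK m); apply: MD.
move=> b; have /spanS[v [c [hv Ac Eb]]] := hs b.
have -> : s * (s - m) * b = (s - m) * v + c * ((s - m) * e n.+1).
  by rewrite (_ : s * (s - m) * b = (s - m) * (s * b)); [rewrite Eb; ring | ring].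
by apply: spanD => //; [apply: spanZ hv | apply: spanZ he] => x hx; apply: subringM.
Qed.

Lemma eq_fraction S x s y t u : S s -> S t -> S u ->
  (forall v w, S v -> S w -> S (v * w)) ->
  u * (x * t - y * s) = 0 -> fraction S x s = fraction S y t.
Proof.
move=> + + Su SM; move: x y s t.
(* The two inclusions are exchanged by symmetry. *)
suff H x y s t : S s -> S t -> u * (x * t - y * s) = 0 ->
    fraction S x s `<=` fraction S y t.
  move=> x y s t Ss St E; apply/seteqP; split; apply: H => //.
  by rewrite -[RHS]oppr0 -E; ring.
move=> Ss St E [z r] /= [Sr [v Sv F]]; split=> //.
exists (s * (u * v)); first exact: SM Ss (SM _ _ Su Sv).
have -> : s * (u * v) * (y * r - z * t) =
  t * u * (v * (x * r - z * s)) - r * v * (u * (x * t - y * s)) by ring.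
by rewrite E F !mulr0 subrr.
Qed.

Lemma prime_complM A P : subring A -> prime_ideal_of A P ->
  forall v w, (A `\` P) v -> (A `\` P) w -> (A `\` P) (v * w).
Proof.
move=> hA [_ hP] v w [Av nPv] [Aw nPw]; split; first exact: subringM.
by case/(hP v w Av Aw).
Qed.

Lemma localization_denominator A P s : subring A -> prime_ideal_of A P ->
  A s -> ~ P s -> (forall b, A (s * b)) ->
  localization_at A P setT `<=` localization_at A P A.
Proof.
move=> hA hP As nPs hs _ [[x t] [_ St] <-] /=; have SM := prime_complM hA hP.
have Ss : (A `\` P) s by [].
exists (s * x, s * t); first by split; [apply: hs | apply: SM].
by apply: (@eq_fraction _ _ _ _ _ s) => //=; [apply: SM | ring].
Qed.

Lemma localization_eq_denominator A P x : subring A -> prime_ideal_of A P ->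
  localization_at A P A = localization_at A P setT ->
  exists s, [/\ A s, ~ P s & A (s * x)].
Proof.
move=> hA hP E; have SM := prime_complM hA hP.
have S1 : (A `\` P) 1.
  split; first exact: subring1.
  by case: hP => -[iP nP] _; apply/(proper_ideal1 hA iP).
have : localization_at A P setT (fraction (A `\` P) x 1) by exists (x, 1).
rewrite -E => -[[a t] [/= Aa St] F].
have : fraction (A `\` P) x 1 (x, 1).
  by split=> //; exists 1; rewrite // !mulr1 subrr mulr0.
rewrite -F => -[_ /= [u Su]]; rewrite mulr1 mulrBr => /eqP.
rewrite subr_eq0 => /eqP G; have [Aut nPut] := SM _ _ Su St.
exists (u * t); split=> //.
rewrite (_ : u * t * x = u * (x * t)); last by ring.
by rewrite -G; apply: subringM => //; case: Su.
Qed.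

Lemma finite_crucial_ideal A M : minimal_extension A -> crucial_ideal A M ->
  finite_extension A -> ideal_of setT M.
Proof.
move=> hAB [hM _ [_ nloc]] hfin; case: (hAB) => hA _ _.
have hJ := extended_ideal_ideal M.
have [JA|hB] := minimal_sum_ideal hAB hJ; last first.
  have [s [As nMs hs]] := nakayama hA hM hfin hB.
  by case: nloc; apply: localization_denominator hs => //; apply: maximal_prime.
case: (hM) => _ maxM; rewrite -(maxM (extended_ideal M)) //; last first.
  exact: sub_extended_ideal.
case: (hJ) => _ J0 hD hZ; split; first by split=> // a x _; apply: hZ.
move=> e; have [x nAx] := proper_setT hAB; apply: nAx; apply: JA.
rewrite -[x]mulr1; apply: hZ => //; rewrite e; exact: subring1.
Qed.

(** An equation of [x] with unit linear coefficient yields a monic one: a leading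
    coefficient in [M] is absorbed by the constant term, since [M] is an ideal
    of [B] contained in [A], and any other one is invertible modulo [M]. *)
Lemma monic_equation A M x N b : subring A -> maximal_ideal_of A M ->
  ideal_of setT M -> span A (GRing.exp x) N b -> A (x - x ^+ 2 * b) ->
  exists n, span A (GRing.exp x) n.+1 (x ^+ n.+1).
Proof.
move=> hA hM [_ _ _ MZ].
have AD u v : A u -> A v -> A (u + v) by apply: subringD.
have A0 := subring0 hA.
have MA : M `<=` A by case: hM => -[[]].
elim: N b => [|N IHN] b.
  move=> [c _ ->]; rewrite big_ord0 mulr0 subr0 => Ax.
  by exists 0; rewrite expr1; apply: span_head.
move=> /spanS[w [c [hw Ac ->]]] E.
have [Mc|nMc] := EM (M c).
  apply: (IHN w hw).
  have -> : x - x ^+ 2 * w =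
    (x - x ^+ 2 * (w + c * x ^+ N)) + (x ^+ 2 * x ^+ N) * c by ring.
  by apply: AD => //; apply: MA; apply: MZ.
have [d Ad hd] := maximal_inverse hA hM Ac nMc.
exists N.+1; set k := x - _ in E.
have -> : x ^+ N.+2 = d * (x - k + - 1 * (x * (x * w))) + x ^+ N.+2 * (1 - d * c).
  by rewrite /k !exprS; ring.
have AN1 : A (- 1) by apply: subringN => //; apply: subring1.
apply: spanD => //; last by apply: span_head => //; apply: MA; apply: MZ.
apply: (@spanZ A) => [y hy|]; first exact: subringM.
apply: spanD => //.
  apply: spanD => //; last by apply: span_head => //; apply: subringN.
  elim: (N) => [|n IHn]; last exact: span_widen.
  apply/spanS; exists 0, 1; split; [exact: span0 | exact: subring1 |].
  by rewrite expr1 mul1r add0r.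
apply: (@spanZ A) => [y hy|]; first exact: subringM.
by do 2![apply: span_shift => //].
Qed.

Lemma crucial_ideal_finite A M : minimal_extension A ->
  maximal_ideal_of A M -> ideal_of setT M -> finite_extension A.
Proof.
move=> hAB hM iM; case: (hAB) => hA _ _.
have AD u v : A u -> A v -> A (u + v) by apply: subringD.
have A0 := subring0 hA; have A1 := subring1 hA.
have [x nAx] := proper_setT hAB.
have expA n a w : A a -> span A (GRing.exp x) n w ->
    span A (GRing.exp x) n (a * w).
  by move=> Aa; apply: spanZ => y; apply: subringM.
suff [n hn] : exists n, span A (GRing.exp x) n.+1 (x ^+ n.+1).
  apply: (@span_finite A (GRing.exp x) n.+1).
  apply: (@minimal_stable_top A x) => //.
  - exact: span_head.
  - by move=> v w; apply: spanD.
  - by move=> a w; apply: expA.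
  - move=> w /(span_shift A0)/spanS[v [c [hv Ac ->]]].
    by apply: spanD => //; apply: expA.
have [JA|hB] := minimal_sum_ideal hAB (principal_ideal (x ^+ 2)).
  exists 1; apply: span_head => //; apply: JA.
  by exists 1; rewrite // mulr1.
have [a Aa [b _ E]] := hB x.
have [N hN] : exists N, span A (GRing.exp x) N b.
  apply: (@minimal_stable_top A x (fun z => exists N, span A (GRing.exp x) N z)) => //.
  - by exists 1; apply: span_head.
  - move=> v w [m hm] [n hn]; exists (m + n)%N.
    apply: spanD => //.
      by elim: n {hn} => [|n IHn]; rewrite ?addn0 // addnS; apply: span_widen.
    by elim: m {hm} => [|m IHm]; rewrite ?add0n // addSn; apply: span_widen.
  - by move=> c w Ac [n hn]; exists n; apply: expA.
  - by move=> w [n hn]; exists n.+1; apply: span_shift.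
by apply: (monic_equation hA hM iM hN); rewrite E opprB addrC subrK.
Qed.

(** * The A-prime ideals of B *)

Lemma crucial_A_prime A M : subring A -> maximal_ideal_of A M ->
  ideal_of setT M -> A_prime_ideal A M.
Proof.
move=> hA hM iM; split.
  split=> //; apply/(proper_ideal1 subringT iM).
  by case: hM => -[jM nM] _; apply/(proper_ideal1 hA jM).
move=> a b Aa Mab; have [|nMa] := EM (M a); [by left | right].
have [a' Aa' hm] := maximal_inverse hA hM Aa nMa.
case: iM => _ _ hD hZ.
have -> : b = a' * (a * b) + b * (1 - a' * a) by ring.
by apply: hD; apply: hZ.
Qed.

(** A proper ideal [J] larger than [M] meets [A] in [M].  For [x] in [J] outside
    [M], the square of [x] is not in [A], as it would then be in [M]; so there is
    a relation [x = a + x^2 b], which gives [x (1 - x b) = a] in [J], hence in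
    [M]; then [1 - x b] is in [M] and [1] is in [J]. *)
Lemma prime_crucial_maximal A M : minimal_extension A ->
  maximal_ideal_of A M -> prime_ideal_of setT M -> maximal_ideal_of setT M.
Proof.
move=> hAB hM [pM MP]; split=> // J [iJ nJ] MJ; case: (hAB) => hA _ _.
have nJ1 : ~ J 1 by apply/(proper_ideal1 subringT iJ).
case: (iJ) => _ J0 JD JZ.
have JAM x : J x -> A x -> M x.
  case: hM => -[[MA _ _ _] _] maxM Jx Ax; rewrite -(maxM (J `&` A)) //.
    split; first exact: ideal_contract.
    move=> e; have : A 1 by apply: subring1.
    by rewrite -{1}e => -[].
  by move=> m hm; split; [apply: MJ | apply: MA].
apply/seteqP; split=> // x Jx; apply: contrapT => nMx.
have [KA|hB] := minimal_sum_ideal hAB (principal_ideal (x ^+ 2)).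
  have : M (x * x).
    apply: JAM; first exact: JZ.
    by apply: KA; exists 1; rewrite // mulr1.
  by case/MP.
have [a Aa [b _ E]] := hB x.
have Ea : a = x * (1 - x * b).
  by rewrite -[a](opprK) -[- a](addKr x) -E; ring.
have : M (x * (1 - x * b)).
  by rewrite -Ea; apply: JAM => //; rewrite Ea mulrC; apply: JZ.
case/MP => // /MJ h; apply: nJ1.
by rewrite -[1](subrK (x * b)); apply: JD => //; rewrite mulrC; apply: JZ.
Qed.

Lemma A_prime_contract A I : subring A -> A_prime_ideal A I ->
  prime_ideal_of A (I `&` A).
Proof.
move=> hA [[iI nI] hI]; split.
  split; first exact: ideal_contract.
  apply/(proper_ideal1 hA (ideal_contract hA iI)) => -[I1 _].
  by move/(proper_ideal1 subringT iI): nI; apply.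
by move=> a b Aa Ab [/(hI _ _ Aa)[Ia|Ib] _]; [left | right].
Qed.

(** Elements of [B] become elements of [A] after multiplication by a denominator
    outside [I], and [A]-primality allows to cancel that denominator. *)
Lemma A_prime_local A I : subring A -> A_prime_ideal A I ->
  localization_at A (I `&` A) A = localization_at A (I `&` A) setT ->
  prime_ideal_of setT I.
Proof.
move=> hA aI E; have hP := A_prime_contract hA aI; case: aI => pI hI.
split=> // x y _ _ Ixy; case: (pI) => -[_ _ _ hZ] _.
have [s [As nPs Asx]] := localization_eq_denominator x hA hP E.
have [t [At nPt Aty]] := localization_eq_denominator y hA hP E.
have cancel u z : A u -> ~ (I `&` A) u -> I (u * z) -> I z.
  by move=> Au nPu /(hI _ _ Au)[Iu|//]; case: nPu.
have : I (s * x * (t * y)).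
  by rewrite mulrACA; apply: hZ.
by case/(hI _ _ Asx) => /cancel h; [left | right]; apply: h.
Qed.

Lemma A_prime_sum A I : A_prime_ideal A I ->
  (forall b, exists2 a, A a & I (b - a)) -> prime_ideal_of setT I.
Proof.
move=> [pI hI] hB; split=> // x y _ _ Ixy; case: (pI) => iI _.
have [a Aa hx] := hB x; case: (iI) => _ _ hD hZ.
have : I (a * y).
  have -> : a * y = x * y - y * (x - a) by ring.
  by apply: (idealB subringT iI) => //; apply: hZ.
case/(hI _ _ Aa) => [Ia|]; [left | by right].
by rewrite -[x](subrK a); apply: hD.
Qed.

End Minimal.

Theorem proposition2p9 (B : comPzRingType) (A M : set B)
    (hAB : minimal_extension A) (hM : crucial_ideal A M) :
  PSI_extension A <->
    (~ finite_extension A \/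
     (finite_extension A /\ maximal_ideal_of setT M)).
Proof.
case: (hAB) (hM) => hA _ _ [mM hloc _]; split=> [psi|alt I aI].
  have [hfin|] := EM (finite_extension A); [right | by left].
  split=> //; apply: (prime_crucial_maximal hAB mM); apply: psi.
  by apply: crucial_A_prime => //; apply: finite_crucial_ideal hfin.
have hP := A_prime_contract hA aI.
have [eP|nP] := EM (I `&` A = M); last exact: (A_prime_local hA aI (hloc _ hP nP)).
have iI : ideal_of setT I by case: aI => -[].
have [IA|hB] := minimal_sum_ideal hAB iI; last exact: A_prime_sum hB.
have eI : I = M by rewrite -eP; apply/esym/setIidPl.
rewrite eI in iI *; have hfin := crucial_ideal_finite hAB mM iI.
by case: alt => // -[_]; apply: maximal_prime; apply: subringT.
Qed.
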